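(* Let $X$ be a space having countable tightness and a rich family of Baire subspaces. Let $f\colon X\times Y\to Z$ be a separately continuous mapping, where $Y\times Y$ is countably compact and $Z$ is a pseudo-metric space. Then there exists a dense set $J\subseteq X$ such that $f$ is jointly continuous at each point of $J\times Y$. (So $X$ is an $\mathcal{N}$-space.)
   Context: No separation axioms are assumed; ''compact'' means every open cover has a finite subcover, and ''countably compact'' means every countable open cover has a finite subcover. $X$ has countable tightness if for each $A\subseteq X$ and $p\in\overline{A}$ there is a countable $C\subseteq A$ with $p\in\overline{C}$. Let $\mathcal{S}_{\mathrm{cl}}(X)$ be the family of non-void closed separable subspaces of $X$. A subfamily $\mathcal{F}\subseteq\mathcal{S}_{\mathrm{cl}}(X)$ is a rich family for $X$ if every $A\in\mathcal{S}_{\mathrm{cl}}(X)$ is contained in some $F\in\mathcal{F}$ and $\overline{\bigcup_n F_n}\in\mathcal{F}$ for every increasing sequence $\{F_n\}_{n=1}^\infty$ in $\mathcal{F}$; it is a rich family of Baire subspaces if each member is a Baire space (no non-void open subset is meager) in the subspace topology. A map of two variables is separately continuous if it is continuous in each variable when the other is fixed. $X$ is an $\mathcal{N}$-space if for every compact space $K$ and every separately continuous $g\colon X\times K\to\mathbb{R}$ there is a dense $R\subseteq X$ such that $g$ is jointly continuous at each point of $R\times K$. *)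

(* Defs.v *)
From mathcomp Require Import all_boot all_order all_algebra.
From mathcomp Require Import all_classical all_reals all_analysis.

Set Implicit Arguments.
Unset Strict Implicit.
Unset Printing Implicit Defensive.

Import numFieldNormedType.Exports.
Local Open Scope classical_set_scope.

Definition countably_compact_space (T : topologicalType) : Prop :=
  forall (I : choiceType) (D : set I) (U : I -> set T),
    countable D -> (forall i, D i -> open (U i)) ->
    [set: T] `<=` \bigcup_(i in D) U i ->
    finite_subset_cover D U [set: T].

Definition countable_tightness (T : topologicalType) : Prop :=
  forall (A : set T) (p : T), closure A p ->
    exists C : set T, [/\ countable C, C `<=` A & closure C p].

Definition separable_space (T : topologicalType) : Prop :=
  exists2 C : set T, countable C & dense C.

Definition nowhere_dense (T : topologicalType) (A : set T) : Prop :=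
  interior (closure A) = set0.

Definition meager (T : topologicalType) (A : set T) : Prop :=
  exists2 N : nat -> set T,
    (forall n, nowhere_dense (N n)) & A = \bigcup_n N n.

Definition baire_space (T : topologicalType) : Prop :=
  forall U : set T, open U -> U !=set0 -> ~ meager U.

(* Subspaces carry the subspace topology through [set_type A], which has the
   initial topology of the inclusion. The library's [subspace A] would be
   wrong here: it retopologizes all of T, making each point outside A
   isolated. *)
Definition closed_separable_subspace (T : topologicalType) (A : set T) : Prop :=
  [/\ A !=set0, closed A & separable_space (set_type A)].

Definition rich_family (T : topologicalType) (F : set (set T)) : Prop :=
  [/\ forall A, F A -> closed_separable_subspace A,
      forall A, closed_separable_subspace A -> exists2 B, F B & A `<=` B
    & forall B : nat -> set T, (forall n, F (B n)) ->
        (forall n, B n `<=` B n.+1) -> F (closure (\bigcup_n B n))].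

Definition rich_family_of_baire_subspaces
    (T : topologicalType) (F : set (set T)) : Prop :=
  rich_family F /\ forall A, F A -> baire_space (set_type A).

Definition separately_continuous (X Y Z : topologicalType)
    (f : X * Y -> Z) : Prop :=
  (forall x : X, continuous (fun y : Y => f (x, y))) /\
  (forall y : Y, continuous (fun x : X => f (x, y))).

Definition N_space (R : realType) (X : topologicalType) : Prop :=
  forall (K : topologicalType) (g : X * K -> R),
    cover_compact [set: K] -> separately_continuous g ->
    exists J : set X, dense J /\
      forall (x : X) (y : K), J x -> {for (x, y), continuous g}.

(* Main.v *)
Require Import Defs.
From mathcomp Require Import all_boot all_order all_algebra.
From mathcomp Require Import all_classical all_reals all_analysis.
From mathcomp Require Import lra.
From mathcomp Require Import finmap.

(** Joint continuity along the whole fibre over [x] follows once every positive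
    [e] admits a neighbourhood of [x] on which all the maps [f (., y)] oscillate
    by at most [e], with the same neighbourhood for all [y]. Let [O_e] be the
    open set of points having such a neighbourhood ([small_oscillation]). It
    suffices that countable intersections of dense open subsets of [X] are dense
    and that every [O_e] is dense ([dense_small_oscillation]); the set sought is
    then the intersection of countably many [O_e].

    Both facts are obtained by reflection to a separable subspace. Given
    countably many operators [A n] from points to sets, countable tightness
    and an interlacing argument in the rich family produce a countable [D] whose
    closure is a member of the family, such that every [p] in [D] adherent to
    [A n p] is already adherent to [D `&` A n p]
    ([rich_family_reflects_closure]). Applied to constant operators with dense
    open values, this transfers the Baire property from the members of the
    family to [X] ([rich_family_baire_dense_bigcap]). If [O_e] missed a non-empty
    open set [U], then every [p] in [U] would be adherent to the set of those [x]
    such that [f (x, y)] and [f (p, y)] are far apart for some [y]; a reflecting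
    [D] keeps this failure of equicontinuity at each of its points in [U].

    On the separable Baire space [closure D] such a failure is impossible
    ([equicontinuity_point]). Enumerate [D] as [d] and let [N n] be the set of
    [x] such that [f (x, .)] varies little between any two points [y], [y']
    that the first [n] functions [f (d i, .)] do not separate by more than
    [1/(n+1)]. Countable compactness of [Y * Y] shows that the sets [N n]
    cover the subspace ([close_on_cover]): a cluster point of a sequence of
    counterexamples [(y, y')] is separated by [f (x, .)] but by no [f (d i, .)],
    contradicting the density of [D]. Hence some [N n] is somewhere dense. As
    [Y] is totally bounded for the finitely many functions [f (d i, .)],
    [i < n] ([close_on_net]), uniform control in [y] near a point [p] reduces to
    continuity of [f (., z)] at [p] for finitely many [z]. *)

Import Order.TTheory GRing.Theory Num.Theory.
Import numFieldNormedType.Exports.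
Local Open Scope classical_set_scope.

Set Implicit Arguments.
Unset Strict Implicit.

(** * Cluster points of sequences *)

(** Common consequence of the two compactness hypotheses on the square of the
    second factor: countable compactness, and compactness of both factors. *)
Definition sequences_cluster (T : topologicalType) : Prop :=
  forall u : nat -> T, exists t, cluster (u @ \oo) t.

Lemma cluster_seq_frequently (T : topologicalType) (u : nat -> T) (t : T)
    (V : set T) (N : nat) :
  cluster (u @ \oo) t -> nbhs t V -> exists2 n, (N <= n)%N & V (u n).
Proof.
move=> ut tV.
have [|_ [[n /= Nn <-] Vn]] := ut (u @` [set n | (N <= n)%N]) V _ tV.
  by exists N => // n /= Nn; exists n.
by exists n.
Qed.

(** Without a cluster point the complements of the closed tails form a countable
    open cover, and no finite part of it contains all terms of the sequence. *)
Lemma countably_compact_sequences_cluster (T : topologicalType) :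
  countably_compact_space T -> sequences_cluster T.
Proof.
move=> ccT u; apply: contrapT => /forallNP noclu.
pose tail N := [set u n | n in [set n | (N <= n)%N]].
have [|N _||D _ Dcov] := ccT nat setT (fun N => ~` closure (tail N)).
- exact: countableP.
- by apply: closed_openC; exact: closed_closure.
- move=> t _; apply: contrapT => tn; apply: (noclu t) => A B [N _ NA] tB.
  have /contrapT tN : ~ ~ closure (tail N) t by move=> h; apply: tn; exists N.
  have [_ [[n Nn <-] Bn]] := tN _ tB.
  by exists (u n); split => //; exact: NA.
- pose M := \max_(i <- enum_fset D) i.
  have [i /= iD] := Dcov (u M) I; apply; apply: subset_closure.
  by exists M => //=; exact: leq_bigmax_seq.
Qed.

(** A filter without cluster point gives each point an open neighbourhood
    disjoint from some member of the filter; finitely many of these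
    neighbourhoods cover [T], so the intersection of the corresponding members
    is empty. *)
Lemma cover_compactT_compact (T : topologicalType) :
  cover_compact [set: T] -> compact [set: T].
Proof.
move=> cT F FF _; apply: contrapT => /forallNP noclu.
have far t : exists UB : set T * set T,
    [/\ open UB.1, UB.1 t, F UB.2 & UB.2 `&` UB.1 = set0].
  apply: contrapT => tn; apply: (noclu t); split=> // A B FA.
  rewrite nbhsE => -[U [Uo Ut] UB].
  apply/set0P/negP => /eqP AB0; apply: tn; exists (U, A); split => //=.
  by rewrite -subset0 -AB0; exact: setIS.
have [g gP] := choice far.
have [t _|t _|D _ Dcov] := cT T setT (fun t => (g t).1).
- by have [] := gP t.
- by exists t => //; have [] := gP t.
have /filter_ex[s sI] : F (\bigcap_(t in [set` D]) (g t).2).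
  by apply: filter_bigI => t _; have [] := gP t.
have [t /= tD st] := Dcov s I.
have [_ _ _ h] := gP t.
by have : ((g t).2 `&` (g t).1) s; [split => //; exact: sI | rewrite h].
Qed.

Lemma compact_sequences_cluster (T : topologicalType) :
  compact [set: T] -> sequences_cluster T.
Proof.
move=> cT u; have [|t [_ ut]] := cT (u @ \oo) _; first exact: filterT.
by exists t.
Qed.

(** * Separable and Baire subspaces *)

Lemma closed_separable_closure (T : topologicalType) (D : set T) :
  countable D -> D !=set0 -> closed_separable_subspace (closure D).
Proof.
move=> cD [x Dx]; split.
- by exists x; exact: subset_closure.
- exact: closed_closure.
exists [set a : closure D | D (val a)].
  move: cD => /countable_injP[f finj]; apply/countable_injP.
  exists (f \o val) => a b /set_mem Da /set_mem Db ab; apply: val_inj.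
  by apply: finj => //; exact: mem_set.
move=> V [[a aD] Va] [W Wo WV]; subst V; move: Va => /= Wa.
have [b [Db Wb]] : D `&` W !=set0.
  by apply: (set_mem aD); exact: open_nbhs_nbhs.
exists (SigSub (mem_set (subset_closure Db) : b \in closure D)).
by split.
Qed.

Lemma separable_subspace_dense_part (T : topologicalType) (A : set T) :
  separable_space (set_type A) ->
  exists C, [/\ countable C, C `<=` A & A `<=` closure C].
Proof.
move=> [C cC dC]; exists (val @` C); split.
- exact: (card_le_trans (card_image_le _ _)).
- by move=> _ [a _ <-]; exact: set_valP.
move=> x Ax B; rewrite nbhsE => -[W [Wo Wx] WB].
have [||a [Wa Ca]] := dC (val @^-1` W).
- by exists (SigSub (mem_set Ax)).
- by exists W.
by exists (val a); split; [exists a | exact: WB].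
Qed.

(** The form in which the Baire property is used: when countably many sets cover
    a non-empty relatively open part of [A], one of them is dense in a smaller
    one. Everything is expressed by subsets of the ambient space, so that the
    subspace type does not occur in later arguments. *)
Lemma baire_subspace_somewhere_dense (T : topologicalType)
    (A U : set T) (N : nat -> set T) :
  baire_space (set_type A) -> open U -> U `&` A !=set0 ->
  U `&` A `<=` \bigcup_n N n ->
  exists n, exists V, [/\ open V, V `&` A !=set0
    & V `&` A `<=` U `&` closure (A `&` N n)].
Proof.
move=> bA Uo [x [Ux Ax]] UN; apply: contrapT => nP.
apply: (bA (val @^-1` U)); [by exists U | by exists (SigSub (mem_set Ax)) | ].
exists (fun n => val @^-1` (U `&` N n)); last first.
  rewrite eqEsubset; split => [a /= Ua|a [n _ []//]].
  by have [n _ Nn] := UN _ (conj Ua (set_valP a)); exists n.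
move=> n; rewrite /nowhere_dense -subset0 => a.
rewrite /interior /= nbhsE => -[_ [[W Wo <-] Wa] Wcl]; apply: nP; exists n.
exists (U `&` W); split; first exact: openI.
  have [|b [[Ub Nb] Wb]] := Wcl _ Wa (val @^-1` W).
    by apply: open_nbhs_nbhs; split => //; exists W.
  by exists (val b); split => //; exact: set_valP.
move=> y [[Uy Wy] Ay]; split => // B; rewrite nbhsE => -[W' [Wo' Wy'] WB].
have [|b [[Ub Nb] Wb']] := Wcl (SigSub (mem_set Ay)) Wy (val @^-1` W').
  by apply: open_nbhs_nbhs; split => //; exists W'.
by exists (val b); split; [split => //; exact: set_valP | exact: WB].
Qed.

(** * Reflection to a separable member of a rich family *)

Lemma countable_setU (T : Type) (A B : set T) :
  countable A -> countable B -> countable (A `|` B).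
Proof.
move=> cA cB; have -> : A `|` B = \bigcup_(b in [set: bool]) if b then A else B.
  rewrite eqEsubset; split=> [x []|x [[] _]].
  - by exists true.
  - by exists false.
  - by left.
  - by right.
by apply: bigcup_countable => // -[].
Qed.

(** Interlacing: build countable sets [E n] and members [B n] of the family with
    [closure (E n) `<=` B n `<=` closure (E n.+1)], where [E n.+1] also absorbs
    [P p] for [p] in [E n]. The union [D] of the [E n] is closed under [P], and
    the closure of the union of the [B n], a member by richness, is
    [closure D]. *)
Lemma rich_family_closed_under (T : topologicalType) (F : set (set T))
    (P : T -> set T) (x : T) :
  rich_family F -> (forall p, countable (P p)) ->
  exists D, [/\ countable D, D x, forall p, D p -> P p `<=` D & F (closure D)].
Proof.
move=> [Fsep Fcof Funion] cP.
pose S := {D : set T | countable D /\ D x}.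
pose next (D E : S) := [/\ sval D `<=` sval E,
  forall p, sval D p -> P p `<=` sval E &
  exists B, [/\ F B, closure (sval D) `<=` B & B `<=` closure (sval E)]].
have step (D : S) : {E : S | next D E}.
  apply: cid; case: D => D [cD Dx].
  have [|B FB DB] := Fcof (closure D).
    by apply: closed_separable_closure => //; exists x.
  have [_ _ /separable_subspace_dense_part[C [cC CB BC]]] := Fsep _ FB.
  pose E := D `|` (C `|` \bigcup_(p in D) P p).
  have cE : countable E.
    do 2 apply: countable_setU => //.
    exact: bigcup_countable.
  exists (exist _ E (conj cE (or_introl Dx))); split => /=.
  - by move=> p Dp; left.
  - by move=> p Dp q Pq; right; right; exists p.
  - exists B; split => //; apply: (subset_trans BC); apply: closureS.
    by move=> p Cp; right; left.
have [E [_ Enext]] :=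
  @dependent_choice _ next step (exist _ [set x] (conj (countable1 x) erefl)).
have /choice[B BP] := fun n => let: And3 _ _ h := Enext n in h.
pose D := \bigcup_n sval (E n).
exists D; split.
- by apply: bigcup_countable => // n _; case: (E n) => ? [].
- by exists 0%N => //; case: (E 0%N) => ? [].
- move=> p [n _ Ep] q Pq; exists n.+1 => //.
  by have [_ h _] := Enext n; exact: h Pq.
have -> : closure D = closure (\bigcup_n B n).
  rewrite eqEsubset; split.
    apply: closureS => p [n _ Ep]; exists n => //.
    by have [_ h _] := BP n; apply: h; exact: subset_closure.
  rewrite [X in _ `<=` X](closure_id _).1; last exact: closed_closure.
  apply: closureS => p [n _ Bp]; have [_ _ /(_ _ Bp)] := BP n.
  by apply: closureS => q Eq; exists n.+1.
apply: Funion => n; first by have [] := BP n.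
have [_ _ h] := BP n; have [_ h' _] := BP n.+1.
exact: subset_trans h h'.
Qed.

(** For each [n] and [p] with [p] adherent to [A n p], countable tightness gives
    a countable part of [A n p] witnessing it; [D] is closed under adding
    these witnesses. *)
Lemma rich_family_reflects_closure (T : topologicalType) (F : set (set T))
    (A : nat -> T -> set T) (x : T) :
  countable_tightness T -> rich_family F ->
  exists D, [/\ countable D, D x, F (closure D) &
    forall n p, D p -> closure (A n p) p -> closure (D `&` A n p) p].
Proof.
move=> tT rF.
have : forall np : nat * T, exists C, countable C /\
    (closure (A np.1 np.2) np.2 -> C `<=` A np.1 np.2 /\ closure C np.2).
  move=> [n p] /=; have [/tT[C [cC CA Cp]]|nA] := pselect (closure (A n p) p).
    by exists C.
  by exists set0.
move=> /choice[C CP].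
have [|D [cD Dx DC FD]] :=
    rich_family_closed_under (P := fun p => \bigcup_n C (n, p)) x rF.
  by move=> p; apply: bigcup_countable => // n _; have [] := CP (n, p).
exists D; split => // n p Dp /(CP (n, p)).2[/= CA]; apply: closureS => q Cq.
by split; [apply: DC Dp _ _; exists n | exact: CA].
Qed.

(** A countable [D] reflecting the density of every [O n] makes each
    [O n `&` closure D] dense in [closure D], which is a Baire space. *)
Lemma rich_family_baire_dense_bigcap (T : topologicalType) (F : set (set T))
    (O : nat -> set T) :
  countable_tightness T -> rich_family_of_baire_subspaces F ->
  (forall n, open (O n)) -> (forall n, dense (O n)) -> dense (\bigcap_n O n).
Proof.
move=> tT [rF bF] Oo Od U [x Ux] Uo.
have clO n p : closure (O n) p.
  move=> B; rewrite nbhsE => -[W [Wo Wp] WB].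
  have [|q [Wq Oq]] := Od n W _ Wo; first by exists p.
  by exists q; split => //; exact: WB.
have [D [_ Dx FD Dcl]] := rich_family_reflects_closure (fun n _ => O n) x tT rF.
apply: contrapT => UO0.
have [||n [V [Vo [q [Vq Dq]] VN]]] :=
    baire_subspace_somewhere_dense (N := fun n => ~` O n) (bF _ FD) Uo.
- by exists x; split => //; exact: subset_closure.
- move=> y [Uy _]; apply: contrapT => nO; apply: UO0; exists y; split => // n _.
  by apply: contrapT => nOy; apply: nO; exists n.
have [p [Dp Vp]] : D `&` V !=set0 by apply: Dq; exact: open_nbhs_nbhs.
have [r [[Dr Or] Vr]] := Dcl n p Dp (clO n p) V (open_nbhs_nbhs (conj Vo Vp)).
have [_ /(_ (O n))] := VN r (conj Vr (subset_closure Dr)).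
by move=> [|s [[_ nOs] Os]]; [exact: open_nbhs_nbhs | exact: nOs].
Qed.

Lemma countable_eq_range (T : Type) (D : set T) :
  countable D -> D !=set0 -> exists d : nat -> T, D = range d.
Proof.
move=> /pfcard_geP[-> [] //|[d]] _; exists d.
by rewrite eqEsubset; split; [exact: surj | move=> _ [n _ <-]; exact: funS].
Qed.

(** * Separately continuous maps *)

Section JointContinuity.
Context {R : realType} {X Y : topologicalType} {Z : pseudoMetricType R}.
Variable f : X * Y -> Z.
Hypothesis fcont : separately_continuous f.
Hypothesis Ycl : sequences_cluster (Y * Y)%type.

Local Open Scope ring_scope.

Lemma near_left (x : X) (y : Y) (e : R) :
  0 < e -> \forall x' \near x, ball (f (x, y)) e (f (x', y)).
Proof. by move=> e0; have /cvg_ball := fcont.2 y x; exact. Qed.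

Lemma near_right (x : X) (y : Y) (e : R) :
  0 < e -> \forall y' \near y, ball (f (x, y)) e (f (x, y')).
Proof. by move=> e0; have /cvg_ball := fcont.1 x y; exact. Qed.

(** The single index [n] bounds the number of coordinates and fixes the
    tolerance, so that these relations shrink to agreement at all [d i] as [n]
    grows. *)
Definition close_on (d : nat -> X) (n : nat) (y y' : Y) : Prop :=
  forall i : 'I_n, ball (f (d i, y)) n.+1%:R^-1 (f (d i, y')).

(** Otherwise one could choose inductively a sequence whose terms are pairwise
    not [n]-close; but two of its terms lie near a common cluster point. *)
Lemma close_on_net (d : nat -> X) (n : nat) :
  exists s : seq Y, forall y, exists2 z, z \in s & close_on d n z y.
Proof.
apply: contrapT => /forallNP nonet.
have /choice[g gP] : forall s : seq Y, exists y,
    forall z, z \in s -> ~ close_on d n z y.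
  move=> s; have /existsNP[y yP] := nonet s.
  by exists y => z zs zy; apply: yP; exists z.
pose s := fix s k := if k is k'.+1 then g (s k') :: s k' else [::].
have smem j k : (j < k)%N -> g (s j) \in s k.
  elim: k => // k IH; rewrite ltnS leq_eqVlt inE => /predU1P[->|/IH ->].
    by rewrite eqxx.
  by rewrite orbT.
(* The hypothesis concerns pairs, so the sequence is doubled. *)
have [[y y'] clu] := Ycl (fun k => (g (s k), g (s k))).
pose M := [set z | forall i : 'I_n,
  ball (f (d i, y)) (n.+1%:R^-1 / 2) (f (d i, z))].
have yM : nbhs y M.
  by apply: filter_forall => i; apply: near_right; rewrite divr_gt0.
have MT : nbhs (y, y') (M `*` setT).
  by exists (M, setT) => //; split => //; exact: filterT.
have [j _ [/= Mj _]] := cluster_seq_frequently 0%N clu MT.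
have [k jk [/= Mk _]] := cluster_seq_frequently j.+1 clu MT.
apply: (gP (s k) (g (s j))); first exact: smem.
move=> i; apply: (ball_split (z := f (d i, y))); last exact: Mk.
by apply: ball_sym; exact: Mj.
Qed.

(** If every [n] had a pair [u n] of [n]-close points at which [f (x, .)] differs
    by [e], then at a cluster point [(y, y')] of [u] every [f (d i, .)] would
    take indistinguishable values at [y] and [y'], hence so would [f (x, .)] as
    [x] is adherent to the [d i]; but it must separate [y] from [y']. *)
Lemma close_on_cover (d : nat -> X) (e : R) (x : X) :
  0 < e -> closure (range d) x ->
  exists n, forall y y', close_on d n y y' -> ball (f (x, y)) e (f (x, y')).
Proof.
move=> e0 dx; apply: contrapT => /forallNP nP.
have /choice[u uP] : forall n, exists yy : Y * Y, close_on d n yy.1 yy.2 /\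
    ~ ball (f (x, yy.1)) e (f (x, yy.2)).
  move=> n; have /existsNP[y /existsNP[y' /not_implyP yy']] := nP n.
  by exists (y, y').
have [[y y'] clu] := Ycl u.
(* The chain from [f (x, (u n).1)] to [f (x, (u n).2)] passes through
   [f (x, y)], [f (d i, y)], the two values of [f (d i, .)] at [u n],
   [f (d i, y')] and [f (x, y')]: seven steps. *)
pose s := e / 7.
have s0 : 0 < s by rewrite divr_gt0.
have [_ [[i _ <-] [xi xi']]] :=
  dx _ (filterI (near_left x y s0) (near_left x y' s0)).
have [N _ NP] := near_infty_natSinv_lt (PosNum s0).
pose M v := [set z |
  ball (f (d i, v)) s (f (d i, z)) /\ ball (f (x, v)) s (f (x, z))].
have nbhsM v : nbhs v (M v) by apply: filterI; exact: near_right.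
have nbhsMM : nbhs (y, y') (M y `*` M y') by exists (M y, M y').
have [n nN [[in_ xn] [in' xn']]] :=
  cluster_seq_frequently (maxn N i.+1) clu nbhsMM.
move: nN; rewrite geq_max => /andP[Nn iltn].
have [cl nb] := uP n; apply: nb.
have {}cl : ball (f (d i, (u n).1)) s (f (d i, (u n).2)).
  by apply: le_ball (cl (Ordinal iltn)); exact/ltW/NP.
have -> : e = s + s + s + s + s + s + s by rewrite /s; lra.
apply: ball_triangle xn'; apply: ball_triangle (ball_sym xi').
apply: ball_triangle (ball_sym in'); apply: ball_triangle cl.
apply: ball_triangle in_; apply: ball_triangle xi.
exact: ball_sym.
Qed.

(** The uniform estimate over all [y] holds near some point [p] of [D], as a
    function on [D] only. Baire category makes some [N n] dense near [p]; there
    [f (x, y)] is controlled by its values at a finite net of points [z], and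
    continuity of the functions [f (., z)] at [p] finishes. *)
Lemma equicontinuity_point (D U : set X) (e : R) :
  countable D -> baire_space (set_type (closure D)) ->
  open U -> U `&` D !=set0 -> 0 < e ->
  exists p, [/\ U p, D p &
    \forall x \near p, D x -> forall y, ball (f (p, y)) e (f (x, y))].
Proof.
move=> cD bD Uo [x0 [Ux0 Dx0]] e0.
have [|d dE] := countable_eq_range cD; first by exists x0.
(* Each [N n] is defined with tolerance [r], which becomes [3 r] on its closure;
   comparing [f (p, y)] with [f (x, y)] through a point [z] of the net costs
   [3 r + r + 3 r]. *)
pose r := e / 7.
have r0 : 0 < r by rewrite divr_gt0.
pose N n := [set x | forall y y',
  close_on d n y y' -> ball (f (x, y)) r (f (x, y'))].
have [||n [V [Vo [q [Vq Dq]] VN]]] :=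
    baire_subspace_somewhere_dense (N := N) bD Uo.
- by exists x0; split => //; exact: subset_closure.
- move=> x [_ Dx]; have [|n nP] := close_on_cover (d := d) (x := x) r0.
    by rewrite -dE.
  by exists n.
have V3 x y y' : V x -> D x -> close_on d n y y' ->
    ball (f (x, y)) (r + r + r) (f (x, y')).
  move=> Vx Dx yy'; have [_ clx] := VN x (conj Vx (subset_closure Dx)).
  have [x' [[_ Nx'] [x'y x'y']]] :=
    clx _ (filterI (near_left x y r0) (near_left x y' r0)).
  apply: ball_triangle (ball_sym x'y'); apply: ball_triangle (Nx' _ _ yy').
  exact: x'y.
have [p [Dp Vp]] : D `&` V !=set0 by apply: Dq; exact: open_nbhs_nbhs.
exists p; split => //; first by have [] := VN p (conj Vp (subset_closure Dp)).
have [s sP] := close_on_net d n.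
have ps : \forall x \near p, forall z, z \in s -> ball (f (p, z)) r (f (x, z)).
  elim: (s) => [|z t IH]; first by near=> x.
  apply: filterS2 (near_left p z r0) IH => x xz xt z'.
  by rewrite inE => /predU1P[->|/xt].
have pV : nbhs p V by exact: open_nbhs_nbhs.
apply: filterS2 pV ps => x Vx xs Dx y.
have [z zs zy] := sP y.
have -> : e = (r + r + r) + r + (r + r + r) by rewrite /r; lra.
apply: ball_triangle (V3 _ _ _ Vx Dx zy).
by apply: ball_triangle (xs _ zs); exact/ball_sym/V3.
Unshelve. all: by end_near. Qed.

Definition small_oscillation (e : R) : set X :=
  \bigcup_(V in [set V | open V /\ forall x x' y,
     V x -> V x' -> ball (f (x, y)) e (f (x', y))]) V.

Lemma open_small_oscillation (e : R) : open (small_oscillation e).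
Proof. by apply: bigcup_open => V []. Qed.

(** If [U] misses the set, each [p] in [U] is adherent to [A p], the set of
    points at which some [f (., y)] differs from its value at [p] by at least
    [e / 2]. A countable [D] reflecting these adherences contradicts
    [equicontinuity_point]. *)
Lemma dense_small_oscillation (F : set (set X)) (e : R) :
  countable_tightness X -> rich_family_of_baire_subspaces F -> 0 < e ->
  dense (small_oscillation e).
Proof.
move=> tX [rF bF] e0 U [x0 Ux0] Uo; apply: contrapT => Uosc.
pose A p := [set x | exists y, ~ ball (f (p, y)) (e / 2) (f (x, y))].
have clA p : U p -> closure (A p) p.
  move=> Up B; rewrite nbhsE => -[W [Wo Wp] WB]; apply: contrapT => AB.
  have Wball x y : W x -> ball (f (p, y)) (e / 2) (f (x, y)).
    move=> Wx; apply: contrapT => nb; apply: AB; exists x.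
    by split; [exists y | exact: WB].
  apply: Uosc; exists p; split => //; exists W => //; split => // x x' y Wx Wx'.
  by apply: (ball_split (z := f (p, y))); [apply: ball_sym|]; exact: Wball.
have [D [cD Dx0 FD Dcl]] :=
  rich_family_reflects_closure (fun _ => A) x0 tX rF.
have [||p [Up Dp near_p]] := equicontinuity_point (e := e / 2) cD (bF _ FD) Uo.
- by exists x0.
- by rewrite divr_gt0.
have [x [[Dx [y ny]] /(_ Dx y)//]] := Dcl 0%N p Dp (clA p Up) _ near_p.
Qed.

Lemma small_oscillation_continuous (x : X) (y : Y) :
  (forall n, small_oscillation n.+1%:R^-1 x) -> {for (x, y), continuous f}.
Proof.
move=> xosc; apply/cvg_ballP => e e0.
have e20 : 0 < e / 2 by rewrite divr_gt0.
have [n _ /(_ n (leqnn n)) /= ne] := near_infty_natSinv_lt (PosNum e20).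
have [V [Vo VP] Vx] := xosc n.
exists (V, [set y' | ball (f (x, y)) (e / 2) (f (x, y'))]).
  by split; [exact: open_nbhs_nbhs | exact: near_right].
move=> [x' y'] [/= Vx' yy'].
by apply: ball_split yy' _; apply: le_ball (VP x x' y' Vx Vx'); exact: ltW.
Qed.

Lemma joint_continuity_dense (F : set (set X)) :
  countable_tightness X -> rich_family_of_baire_subspaces F ->
  exists J : set X, dense J /\
    forall x y, J x -> {for (x, y), continuous f}.
Proof.
move=> tX rF; exists (\bigcap_n small_oscillation n.+1%:R^-1); split.
  apply: (rich_family_baire_dense_bigcap tX rF) => n.
    exact: open_small_oscillation.
  exact: dense_small_oscillation rF _.
by move=> x y xosc; apply: small_oscillation_continuous => n; exact: xosc.
Qed.

End JointContinuity.

Unset Implicit Arguments.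
Set Strict Implicit.

Theorem theorem4p1 (R : realType) (X : topologicalType)
    (hX : countable_tightness X)
    (hrich : exists F : set (set X), rich_family_of_baire_subspaces F) :
  (forall (Y : topologicalType) (Z : pseudoMetricType R) (f : X * Y -> Z),
     countably_compact_space (Y * Y)%type ->
     separately_continuous f ->
     exists J : set X, dense J /\
       forall (x : X) (y : Y), J x -> {for (x, y), continuous f}) /\
  N_space R X.
Proof.
have [F rF] := hrich; split=> [Y Z f ccY fcont|K g cK gcont].
  apply: (joint_continuity_dense fcont _ hX rF).
  exact: countably_compact_sequences_cluster.
apply: (joint_continuity_dense gcont _ hX rF).
apply: compact_sequences_cluster; rewrite -setXTT.
by apply: compact_setX; exact: cover_compactT_compact.
Qed.
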